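(* Let $\mathfrak C$ be a left cancellative small category. (i) $I_l\ltimes\Omega$ is Hausdorff if and only if for all $s\in I_l$ there exists a (possibly empty) finite subset $\{e_1,\dots,e_n\}\subseteq\mathcal J$ with $\{x\in\mathrm{dom}(s):s(x)=x\}=\bigcup_{i=1}^ne_i$. (ii) $I_l\,\bar\ltimes\,\Omega$ is Hausdorff if and only if for all $s\in I_l$ there exists a (possibly empty) finite subset $\{\varepsilon_1,\dots,\varepsilon_n\}\subseteq\bar{\mathcal J}$ with $\{x\in\mathrm{dom}(s):s(x)=x\}=\bigcup_{i=1}^n\varepsilon_i$.
   Context: $\mathfrak C$ denotes the set of morphisms, $\mathfrak C^0\subseteq\mathfrak C$ the identity morphisms, $\mathfrak d,\mathfrak t$ domain and target; $cd$ is defined iff $\mathfrak d(c)=\mathfrak t(d)$; left cancellative means $cx=cy\Rightarrow x=y$. Each $c\in\mathfrak C$ gives the partial bijection $\mathfrak d(c)\mathfrak C\to c\mathfrak C$, $x\mapsto cx$; $I_l$ is the smallest semigroup of partial bijections of $\mathfrak C$ containing these and closed under inverses; $\mathcal J=\{\mathrm{dom}(s):s\in I_l\}$ is its semilattice of idempotents (product = intersection). $\bar{\mathcal J}$ is the set of subsets $\varepsilon=e\setminus\bigcup_{i=1}^nf_i$ of $\mathfrak C$ with $e,f_1,\dots,f_n\in\mathcal J$, $f_i\subseteq e$. $\widehat{\mathcal J}$ is the space of non-zero multiplicative maps $\chi:\mathcal J\to\{0,1\}$ with $\chi(\emptyset)=0$ if $\emptyset\in\mathcal J$ (pointwise convergence).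 $\Omega\subseteq\widehat{\mathcal J}$ consists of those $\chi$ such that whenever $e=\bigcup_{i=1}^nf_i$ ($e,f_i\in\mathcal J$) and $\chi(e)=1$, then $\chi(f_i)=1$ for some $i$. For $\chi\in\Omega$ and $\varepsilon=e\setminus\bigcup f_i\in\bar{\mathcal J}$, put $\chi(\varepsilon)=1$ iff $\chi(e)=1$ and $\chi(f_i)=0$ for all $i$, and $\chi(\varepsilon)=0$ otherwise (well defined). $s\in I_l$ acts by $\chi\mapsto s.\chi=\chi(s^{-1}\cdot s)$ from $\Omega(s^{-1}s)=\{\chi\in\Omega:\chi(s^{-1}s)=1\}$ onto $\Omega(ss^{-1})$. $I_l\ltimes\Omega$ is the quotient of $\{(s,\chi)\in I_l\times\Omega:\chi(s^{-1}s)=1\}$ by $(s,\chi)\sim(t,\psi)$ iff $\chi=\psi$ and $se=te$ for some $e\in\mathcal J$ with $\chi(e)=1$; $I_l\,\bar\ltimes\,\Omega$ is the quotient by $(s,\chi)\bar\sim(t,\psi)$ iff $\chi=\psi$ and $s\varepsilon=t\varepsilon$ for some $\varepsilon\in\bar{\mathcal J}$ with $\chi(\varepsilon)=1$ (here $se$, $s\varepsilon$ denote restrictions as partial bijections). Both are groupoids with source $\chi$, range $s.\chi$, $[s,t.\chi][t,\chi]=[st,\chi]$, $[s,\chi]^{-1}=[s^{-1},s.\chi]$; in both cases the topology is such that the images of $\{s\}\times\Omega(s^{-1}s)$ are open and mapped homeomorphically onto $\Omega(s^{-1}s)$ by the source map. *)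

(* Defs.v *)
From HB Require Import structures.
From mathcomp Require Import all_boot generic_quotient all_classical topology.

Set Implicit Arguments.
Unset Strict Implicit.
Unset Printing Implicit Defensive.

Local Open Scope classical_set_scope.
Local Open Scope quotient_scope.

(* Objects are identified with their identity morphisms, so that [src] and
   [tgt] take values in the set [c | src c = c] of identities.  The composite
   "c after d" is meaningful only if [src c = tgt d]; [cmp c d] is an
   irrelevant value otherwise, on which no axiom says anything. *)
Record smallCategory := SmallCategory {
  mor :> Type;
  src : mor -> mor;
  tgt : mor -> mor;
  cmp : mor -> mor -> mor;
  src_src : forall c, src (src c) = src c;
  tgt_src : forall c, tgt (src c) = src c;
  src_tgt : forall c, src (tgt c) = tgt c;
  tgt_tgt : forall c, tgt (tgt c) = tgt c;
  src_cmp : forall c d, src c = tgt d -> src (cmp c d) = src d;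
  tgt_cmp : forall c d, src c = tgt d -> tgt (cmp c d) = tgt c;
  cmp_src : forall c, cmp c (src c) = c;
  tgt_cmpl : forall c, cmp (tgt c) c = c;
  cmpA : forall c d x, src c = tgt d -> src d = tgt x ->
    cmp c (cmp d x) = cmp (cmp c d) x
}.

Definition left_cancellative (C : smallCategory) : Prop :=
  forall c x y : C, src c = tgt x -> src c = tgt y -> cmp c x = cmp c y -> x = y.

(* [graph s x y] means that [s] is defined at [x] and [s(x) = y]. *)
Record pbij (T : Type) := PBij {
  graph : T -> T -> Prop;
  graph_fun : forall x y z, graph x y -> graph x z -> y = z;
  graph_inj : forall x y z, graph x z -> graph y z -> x = y
}.

HB.instance Definition _ (T : Type) := gen_eqMixin (pbij T).
HB.instance Definition _ (T : Type) := gen_choiceMixin (pbij T).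

Section PartialBijections.
Context {T : Type}.
Implicit Types (s t : pbij T) (A : set T).

Lemma pbijP s t : (forall x y, graph s x y <-> graph t x y) -> s = t.
Proof.
case: s t => [g gf gi] [h hf hi] /= gh.
have E : g = h by apply/funext => x; apply/funext => y; apply/propext.
by subst h; congr PBij; exact: Prop_irrelevance.
Qed.

Definition pdom s : set T := [set x | exists y, graph s x y].

Definition pfix s : set T := [set x | graph s x x].

Lemma pinv_fun s x y z : graph s y x -> graph s z x -> y = z.
Proof. exact: graph_inj. Qed.

Lemma pinv_inj s x y z : graph s z x -> graph s z y -> x = y.
Proof. exact: graph_fun. Qed.

Definition pinv s : pbij T :=
  @PBij T (fun x y => graph s y x) (@pinv_fun s) (@pinv_inj s).

Lemma pcomp_fun s t x y z :
  (exists2 u, graph t x u & graph s u y) ->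
  (exists2 u, graph t x u & graph s u z) -> y = z.
Proof.
move=> [u tu su] [v tv sv]; rewrite (graph_fun tv tu) in sv.
exact: graph_fun su sv.
Qed.

Lemma pcomp_inj s t x y z :
  (exists2 u, graph t x u & graph s u z) ->
  (exists2 u, graph t y u & graph s u z) -> x = y.
Proof.
move=> [u tu su] [v tv sv]; rewrite (graph_inj sv su) in tv.
exact: graph_inj tu tv.
Qed.

(* [pcomp s t] is "s after t", with the largest possible domain. *)
Definition pcomp s t : pbij T :=
  @PBij T (fun x y => exists2 u, graph t x u & graph s u y)
    (@pcomp_fun s t) (@pcomp_inj s t).

Lemma prestr_fun s A x y z :
  A x /\ graph s x y -> A x /\ graph s x z -> y = z.
Proof. by move=> [_ sy] [_ sz]; exact: graph_fun sy sz. Qed.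

Lemma prestr_inj s A x y z :
  A x /\ graph s x z -> A y /\ graph s y z -> x = y.
Proof. by move=> [_ sx] [_ sy]; exact: graph_inj sx sy. Qed.

(* The restriction of [s] to its domain intersected with [A]. *)
Definition prestr s A : pbij T :=
  @PBij T (fun x y => A x /\ graph s x y) (@prestr_fun s A) (@prestr_inj s A).

Lemma prestrI s t A B : prestr s A = prestr t A ->
  prestr s (A `&` B) = prestr t (A `&` B).
Proof.
move=> st; have H x y : (A x /\ graph s x y) = (A x /\ graph t x y).
  exact: (congr1 (fun u => graph u x y) st).
apply: pbijP => x y /=; split=> -[[Ax Bx] sxy].
- by have [] : A x /\ graph t x y by rewrite -H.
- by have [] : A x /\ graph s x y by rewrite H.
Qed.

Definition inverse_subsemigroup (M : set (pbij T)) : Prop :=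
  (forall s t, M s -> M t -> M (pcomp s t)) /\ (forall s, M s -> M (pinv s)).

End PartialBijections.

Section LeftInverseHull.
Context {C : smallCategory} (lc : left_cancellative C).

Lemma lmul_fun (c x y z : C) :
  src c = tgt x /\ y = cmp c x -> src c = tgt x /\ z = cmp c x -> y = z.
Proof. by move=> [_ ->] [_ ->]. Qed.

Lemma lmul_inj (c x y z : C) :
  src c = tgt x /\ z = cmp c x -> src c = tgt y /\ z = cmp c y -> x = y.
Proof. by move=> [cx ->] [cy /(lc cx cy)]. Qed.

Definition lmul (c : C) : pbij C :=
  @PBij C (fun x y => src c = tgt x /\ y = cmp c x) (@lmul_fun c) (@lmul_inj c).

Definition Il : set (pbij C) := smallest inverse_subsemigroup (range lmul).

Lemma Il_inverse_subsemigroup : inverse_subsemigroup Il.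
Proof.
split=> [s t Is It M HM|s Is M HM]; have [[Mc Mi] _] := HM.
- exact: Mc (Is M HM) (It M HM).
- exact: Mi (Is M HM).
Qed.

Definition J : set (set C) := [set pdom s | s in Il].

Lemma J_pdom (s : Il) : pdom (\val s) \in J.
Proof. by apply/mem_set; exists (\val s) => //; exact: set_valP. Qed.

(* The domain of [s], standing for the idempotent [s^-1 s]. *)
Definition Jdom (s : Il) : J := exist _ (pdom (\val s)) (J_pdom s).

Lemma J_setI (e f : J) : \val e `&` \val f \in J.
Proof.
have [Ic Ii] := Il_inverse_subsemigroup.
have [s Is es] := set_valP e; have [t It ft] := set_valP f.
apply/mem_set; exists (pcomp (pcomp (pinv s) s) (pcomp (pinv t) t)).
  by apply: (Ic) => //; apply: (Ic) => //; apply: Ii.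
rewrite -es -ft; apply/seteqP; split=> [x /=|x [[y sy] [z tz]]].
  move=> [y [u [v tv /= tu] [w sw _]]]; rewrite -(graph_inj tv tu) in sw.
  by split; [exists w|exists v].
by exists x; exists x; [exists z|exists y].
Qed.

Definition Jmeet (e f : J) : J := exist _ (\val e `&` \val f) (J_setI e f).

Definition Jhat : set {ptws J -> bool} :=
  [set chi : {ptws J -> bool} | [/\ exists e : J, chi e,
                 forall e f : J, chi (Jmeet e f) = chi e && chi f
               & forall e : J, \val e = set0 -> chi e = false]].

Definition Omega : set {ptws J -> bool} :=
  [set chi : {ptws J -> bool} | Jhat chi /\
     forall (e : J) (n : nat) (f : 'I_n -> J),
       \val e = \bigcup_i \val (f i) -> chi e -> exists i, chi (f i)].

(* Since [n = 0] is allowed, [J] is contained in [Jbar]. *)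
Definition Jbar : set (set C) :=
  [set eps | exists (e : J) (n : nat) (f : 'I_n -> J),
     (forall i, \val (f i) `<=` \val e) /\
     eps = \val e `\` \bigcup_i \val (f i)].

(* The extension of a character to [Jbar]; by [charbarE] below it does not
   depend on how [eps] is written as a difference. *)
Definition charbar (chi : {ptws J -> bool}) (eps : set C) : Prop :=
  exists (e : J) (n : nat) (f : 'I_n -> J),
    [/\ forall i, \val (f i) `<=` \val e,
        eps = \val e `\` \bigcup_i \val (f i),
        chi e & forall i, ~~ chi (f i)].

Lemma charbarE (chi : Omega) (e : J) (n : nat) (f : 'I_n -> J) :
  (forall i, \val (f i) `<=` \val e) ->
  charbar (\val chi) (\val e `\` \bigcup_i \val (f i)) <->
  (\val chi) e /\ forall i, ~~ (\val chi) (f i).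
Proof.
move=> fe; have [[_ chiM _] chiU] := set_valP chi.
split=> [[e' [n' [f' [f'e' ee' chie' chif']]]]|[? ?]]; last by exists e, n, f.
split.
  have [] := chiU e' n'.+1 (fun i => if unlift ord0 i is Some j then f' j
                               else Jmeet e' e) _ chie'.
    apply/seteqP; split=> [x /= e'x|x [i _]]; last first.
      by case: unliftP => [j _ /f'e'|_ []].
    have [ex|nex] := pselect (\val e x); first by exists ord0; rewrite ?unlift_none.
    have [[j _ f'x]|nf'x] := pselect ((\bigcup_i \val (f' i)) x).
      by exists (lift ord0 j); rewrite ?liftK.
    by have [] : (\val e `\` \bigcup_i \val (f i)) x by rewrite ee'; split.
  move=> i; case: unliftP => [j _|_]; first by move=> H; move: (chif' j); rewrite H.
  by rewrite chiM => /andP[].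
move=> i; apply/negP => chifi.
have chim : \val chi (Jmeet e' (f i)) by rewrite chiM chie'.
have [] := chiU _ n' (fun j => Jmeet (f i) (f' j)) _ chim.
  apply/seteqP; split=> [x /= [e'x fix_]|x [j _ /= [fx f'x]]]; last first.
    by split=> //; exact: f'e' f'x.
  have [[j _ f'x]|nf'x] := pselect ((\bigcup_i \val (f' i)) x); first by exists j.
  have [_ []] : (\val e `\` \bigcup_i \val (f i)) x by rewrite ee'; split.
  by exists i.
by move=> j; rewrite chiM => /andP[_ H]; move: (chif' j); rewrite H.
Qed.

Lemma charbar_setI (chi : Omega) (eps eps' : set C) :
  charbar (\val chi) eps -> charbar (\val chi) eps' ->
  charbar (\val chi) (eps `&` eps').
Proof.
have [[_ chiM _] _] := set_valP chi.
move=> [e [n [f [fe -> chie chif]]]] [e' [n' [f' [f'e' -> chie' chif']]]].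
exists (Jmeet e e'), (n + n')%N, (fun i => match fintype.split i with
  | inl j => Jmeet (f j) e' | inr j => Jmeet e (f' j) end); split.
- move=> i; case: fintype.split => j x /= [].
  + by move=> /fe.
  + by move=> ? /f'e'.
- apply/seteqP; split=> x /=.
    move=> [[ex nf] [e'x nf']]; split=> // -[i _].
    by case: fintype.split => j [? ?]; [apply: nf|apply: nf']; exists j.
  move=> [[ex e'x] nff']; split; split=> // -[j _ fx]; apply: nff'.
    exists (lshift n' j) => //.
    by case: splitP => k /= jk; [rewrite -(ord_inj jk)|have := ltn_ord j; rewrite jk ltnNge leq_addr].
  exists (rshift n j) => //.
  case: splitP => k /= jk; first by have := ltn_ord k; rewrite -jk ltnNge leq_addr.
  by move/addnI: jk => /ord_inj <-.
- by rewrite chiM chie.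
- move=> i; case: fintype.split => j; rewrite chiM negb_and.
  + by rewrite chif.
  + by rewrite chif' orbT.
Qed.

Definition OmegaAt (s : Il) : set Omega := [set chi : Omega | (\val chi) (Jdom s)].

(* The pairs (s, chi) with chi(s^-1 s) = 1, with the topology of the disjoint
   union of the spaces [OmegaAt s]. *)
Definition pairs : topologicalType := {s : Il & OmegaAt s}.

Definition pel (p : pairs) : pbij C := \val (projT1 p).
Definition pchi (p : pairs) : Omega := \val (projT2 p).

Definition germ (p q : pairs) : Prop :=
  pchi p = pchi q /\
  exists2 e : J, (\val (pchi p)) e &
    prestr (pel p) (\val e) = prestr (pel q) (\val e).

Definition germbar (p q : pairs) : Prop :=
  pchi p = pchi q /\
  exists2 eps : set C, Jbar eps /\ charbar (\val (pchi p)) eps &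
    prestr (pel p) eps = prestr (pel q) eps.

Lemma charbar_J (chi : {ptws J -> bool}) (e : J) : chi e -> charbar chi (\val e).
Proof.
move=> ?; exists e, 0%N, (fun=> e); split=> [[]//|||[]//] //.
by apply/seteqP; split=> [x ex|x []//]; split=> // -[[]].
Qed.

Lemma charbar_Jbar (chi : {ptws J -> bool}) (eps : set C) :
  charbar chi eps -> Jbar eps.
Proof. by move=> [e [n [f [? ? _ _]]]]; exists e, n, f. Qed.

Lemma germ_equiv : equiv_class_of (fun p q => `[< germ p q >]).
Proof.
split=> [p|p q|q p r].
- apply/asboolP; split=> //.
  by have [[[e ?] _ _] _] := set_valP (pchi p); exists e.
- by apply/asboolP/asboolP => -[pq [e chie E]]; split=> //;
    exists e => //; [rewrite -pq|rewrite -pq].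
- move=> /asboolP[pq [e chie E]] /asboolP[qr [f chif F]].
  apply/asboolP; split; first by rewrite pq.
  have [[_ chiM _] _] := set_valP (pchi p); rewrite -pq in chif.
  exists (Jmeet e f); first by rewrite chiM chie.
  by rewrite /= (prestrI _ E) setIC (prestrI _ F).
Qed.

Lemma germbar_equiv : equiv_class_of (fun p q => `[< germbar p q >]).
Proof.
split=> [p|p q|q p r].
- apply/asboolP; split=> //.
  have [[[e chie] _ _] _] := set_valP (pchi p); exists (\val e) => //.
  by have H := charbar_J chie; split=> //; exact: charbar_Jbar H.
- by apply/asboolP/asboolP => -[pq [e [? ?] E]]; split=> //;
    exists e => //; split=> //; rewrite -pq.
- move=> /asboolP[pq [e [_ chie] E]] /asboolP[qr [f [_ chif] F]].
  apply/asboolP; split; first by rewrite pq.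
  rewrite -pq in chif; have H := charbar_setI chie chif.
  exists (e `&` f); first by split=> //; exact: charbar_Jbar H.
  by rewrite (prestrI _ E) setIC (prestrI _ F).
Qed.

Definition germ_rel : equiv_rel pairs := EquivRelPack germ_equiv.
Definition germbar_rel : equiv_rel pairs := EquivRelPack germbar_equiv.

Definition germ_space (r : equiv_rel pairs) : topologicalType :=
  quotient_topology {eq_quot r}.

(* The class [s, chi]. *)
Definition germ_class (r : equiv_rel pairs) (s : Il) (chi : OmegaAt s) :
  germ_space r := \pi_(quotient_topology {eq_quot r}) (existT _ s chi).

Definition germ_source (r : equiv_rel pairs) (g : germ_space r) : Omega :=
  pchi (repr g).

(* The underlying topological spaces of the groupoids of germs for ~ and ~bar;
   being Hausdorff does not involve the groupoid operations. *)
Definition germs : topologicalType := germ_space germ_rel.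
Definition germsbar : topologicalType := germ_space germbar_rel.

(* The lemmas below, summed up in [germs_topology] and [germsbar_topology],
   show that the image of {s} x Omega(s^-1 s) is open and is mapped
   homeomorphically onto Omega(s^-1 s) by the source map: [germ_class] is
   continuous and open, with continuous left inverse [germ_source].  Since these
   images cover, this determines the topology. *)

Lemma open_eval (e : J) (b : bool) : open [set chi : Omega | (\val chi) e = b].
Proof.
have /continuousP H : continuous ((fun chi => chi e) : {ptws J -> bool} -> bool).
  exact: (@proj_continuous _ (fun _ : J => bool) e).
have o1 := H [set b] (discrete_open _).
by exists [set chi : {ptws J -> bool} | chi e = b].
Qed.

Section GermTopology.
Variable r : equiv_rel pairs.
Hypothesis r_source : forall p q, r p q -> pchi p = pchi q.
Hypothesis r_open : forall p q, r p q -> exists W : set Omega,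
  [/\ open W, W (pchi p) & forall p' q', pel p' = pel p -> pel q' = pel q ->
    pchi p' = pchi q' -> W (pchi p') -> r p' q'].

Lemma germ_class_eq s t (chi : OmegaAt s) (psi : OmegaAt t) :
  germ_class r chi = germ_class r psi <-> r (existT _ s chi) (existT _ t psi).
Proof. by split=> [/eqmodP|H]; last exact/eqmodP. Qed.

Lemma germ_space_openP (V : set (germ_space r)) :
  open V <-> forall s : Il, open [set chi : OmegaAt s | V (germ_class r chi)].
Proof. exact: (sigT_openP (\pi_(quotient_topology {eq_quot r}) @^-1` V)). Qed.

Lemma germ_sourceE s (chi : OmegaAt s) :
  germ_source (germ_class r chi) = \val chi.
Proof.
rewrite /germ_source; have := reprK (germ_class r chi).
by move=> /eqmodP /r_source.
Qed.

Lemma germ_class_continuous s : continuous (@germ_class r s).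
Proof. by apply/continuousP => V /germ_space_openP. Qed.

Lemma germ_source_continuous : continuous (@germ_source r).
Proof.
apply/continuousP => V oV; apply/germ_space_openP => s /=; exists V => //.
by apply/seteqP; split=> chi /=; rewrite germ_sourceE.
Qed.

Lemma germ_class_open s (U : set (OmegaAt s)) :
  open U -> open (@germ_class r s @` U).
Proof.
move=> [V oV VU]; apply/germ_space_openP => t.
rewrite openE => chi [psi Upsi /germ_class_eq rpc].
have chipsi : \val psi = \val chi := r_source rpc.
have [W [oW Wpsi rW]] := r_open rpc; rewrite /interior nbhsE /=.
exists [set om : OmegaAt t | [/\ V (\val om), W (\val om) & OmegaAt s (\val om)]].
  split; last first.
    split; rewrite -?chipsi //; first by move: Upsi; rewrite -VU.
    exact: set_valP psi.
  exists (V `&` W `&` OmegaAt s).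
    apply: openI; first exact: openI.
    by have := open_eval (Jdom s) true.
  by apply/seteqP; split=> om /= => [[[]]|[]].
move=> om [Vom Wom som] /=.
exists (exist _ (\val om) (mem_set som)); first by rewrite -VU.
by apply/germ_class_eq; apply: rW.
Qed.

End GermTopology.

Lemma germ_rel_source p q : germ_rel p q -> pchi p = pchi q.
Proof. by move=> /asboolP[]. Qed.

Lemma germbar_rel_source p q : germbar_rel p q -> pchi p = pchi q.
Proof. by move=> /asboolP[]. Qed.

Lemma germ_rel_open p q : germ_rel p q -> exists W : set Omega,
  [/\ open W, W (pchi p) & forall p' q', pel p' = pel p -> pel q' = pel q ->
    pchi p' = pchi q' -> W (pchi p') -> germ_rel p' q'].
Proof.
move=> /asboolP[pq [e chie E]]; exists [set chi : Omega | (\val chi) e].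
split=> //; first exact: (open_eval e true).
move=> p' q' pp' qq' pq' We; apply/asboolP; split=> //.
by exists e => //; rewrite pp' qq'.
Qed.

Lemma germbar_rel_open p q : germbar_rel p q -> exists W : set Omega,
  [/\ open W, W (pchi p) & forall p' q', pel p' = pel p -> pel q' = pel q ->
    pchi p' = pchi q' -> W (pchi p') -> germbar_rel p' q'].
Proof.
move=> /asboolP[pq [eps [Jeps [e [n [f [fe epsE chie chif]]]]] E]].
exists ([set chi : Omega | (\val chi) e] `&`
  [set chi : Omega | forall i, (\val chi) (f i) = false]); split.
- apply: openI; first exact: (open_eval e true).
  rewrite openE => chi chi0; rewrite /interior.
  apply: (@filter_forall _ _ (fun i => [set om : Omega | (\val om) (f i) = false])
    (nbhs chi) _) => i.
  by apply: open_nbhs_nbhs; split; [exact: (open_eval (f i) false)|exact: chi0].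
- by split=> // i; exact/negbTE.
move=> p' q' pp' qq' pq' [We Wf]; apply/asboolP; split=> //.
exists eps; last by rewrite pp' qq'.
split=> //; exists e, n, f; split=> // i.
by apply/negbT; exact: Wf.
Qed.

Lemma germs_topology (s : Il) :
  [/\ continuous (@germ_class germ_rel s),
      forall U, open U -> open (@germ_class germ_rel s @` U),
      forall chi : OmegaAt s, germ_source (germ_class germ_rel chi) = \val chi
    & continuous (@germ_source germ_rel)].
Proof.
split.
- exact: germ_class_continuous.
- exact: germ_class_open germ_rel_source germ_rel_open s.
- exact: germ_sourceE germ_rel_source s.
- exact: germ_source_continuous germ_rel_source.
Qed.

Lemma germsbar_topology (s : Il) :
  [/\ continuous (@germ_class germbar_rel s),
      forall U, open U -> open (@germ_class germbar_rel s @` U),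
      forall chi : OmegaAt s, germ_source (germ_class germbar_rel chi) = \val chi
    & continuous (@germ_source germbar_rel)].
Proof.
split.
- exact: germ_class_continuous.
- exact: germ_class_open germbar_rel_source germbar_rel_open s.
- exact: germ_sourceE germbar_rel_source s.
- exact: germ_source_continuous germbar_rel_source.
Qed.

End LeftInverseHull.

(* Main.v *)
(* Every character in [Omega] has the form [e |-> (e \in G)] for an ultrafilter
   [G] on the set of morphisms, and [charbar] then is membership in [G] too, so
   that [Omega] is the closure of the characters [e |-> (x \in e)] given by the
   morphisms [x].  Let K be J or Jbar.  Two germs [s, chi] and [t, chi] coincide
   iff chi is 1 on some element of K contained in the set where s and t agree,
   which is the fixed point set of t^-1 s.
   If this set is a finite union of elements of K, then the characters that
   vanish on all of them form an open set over which s and t have no common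
   germ, which separates [s, chi] from [t, chi] if these differ.
   Conversely, if the fixed point set of s is not a finite union of elements of
   K, some ultrafilter contains it and no element of K inside it.  The
   corresponding chi has [s, chi] <> [s^-1 s, chi], but chi is a limit of
   characters given by fixed points x of s, at which the germs of s and s^-1 s
   coincide because s fixes the whole right ideal xC; so the two germs cannot be
   separated. *)
Require Import Defs.
From mathcomp Require Import all_boot all_classical topology.

Local Open Scope classical_set_scope.

Definition set_elt {T : Type} {A : set T} {x : T} (Ax : A x) : A :=
  exist _ x (mem_set Ax).

(** * Ultrafilters, complements and finite unions *)

Section UltraFilters.
Context {T : Type} (G : set_system T) {uG : UltraFilter G}.

Lemma ultra_setC (A : set T) : G (~` A) <-> ~ G A.
Proof.
split=> [GcA GA|nGA]; last by case: (in_ultra_setVsetC A uG).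
by have [x []] := filter_ex (filterI GA GcA).
Qed.

Lemma ultra_bigcup (I : finType) (f : I -> set T) :
  G (\bigcup_i f i) <-> exists i, G (f i).
Proof.
split=> [Gf|[i]]; last by apply: filterS => x fx; exists i.
apply: contrapT => nG; have : G (~` \bigcup_i f i).
  rewrite setC_bigcup; suff: \forall x \near G, forall i, (~` f i) x.
    by apply: filterS => x H i _; exact: H.
  by apply: filter_forall => i; apply/ultra_setC => Gi; apply: nG; exists i.
by move/ultra_setC; apply.
Qed.

End UltraFilters.

(** * Characters as ultrafilters, and approximation by points *)

Section Characters.
Context {C : smallCategory} {lc : left_cancellative C}.

(** An ultrafilter decides complements and finite unions, so its trace on [J] determines its trace
    on [Jbar]. *)
Lemma charbar_ultra {om : Omega (lc:=lc)} {G : set_system C} {eps : set C} :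
  UltraFilter G -> (forall e, \val om e <-> G (\val e)) ->
  Jbar lc eps -> charbar (\val om) eps <-> G eps.
Proof.
move=> uG omG [e [n [f [fe ->]]]]; rewrite charbarE// omG.
rewrite setDE; split=> [[Ge nf]|Gef].
  apply: filterI => //; apply/ultra_setC => /ultra_bigcup[i /omG].
  exact/negP.
split=> [|i]; first by apply: filterS Gef => x [].
have [_ /ultra_setC nG] : G (\val e) /\ G (~` (\bigcup_i \val (f i))).
  by split; apply: filterS Gef => x [].
by apply/negP => /omG Gi; apply: nG; apply/ultra_bigcup; exists i.
Qed.

(** Ultrafilters are prime, which yields the covering condition of [Omega]; [e0] makes the character
    non-zero. *)
Lemma ultra_Omega {G : set_system C} {e0 : J lc} :
  UltraFilter G -> G (\val e0) ->
  exists om : Omega (lc:=lc), forall e, \val om e <-> G (\val e).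
Proof.
move=> uG G0.
pose chi : {ptws J lc -> bool} := fun e : J lc => `[< G (\val e) >].
have chiP : Omega (lc:=lc) chi.
  split; first split.
  - by exists e0; apply/asboolP.
  - move=> e f; apply/asboolP/andP => [Gef|[/asboolP Ge /asboolP Gf]].
      by split; apply/asboolP; apply: filterS Gef => x [].
    exact: filterI.
  - move=> e e_0; apply/negbTE/asboolPn; rewrite e_0.
    exact: filter_not_empty.
  - move=> e n f ef /asboolP; rewrite ef => /ultra_bigcup[i Gi].
    by exists i; apply/asboolP.
exists (set_elt chiP) => e; split=> [/asboolP//|Ge].
exact/asboolP.
Qed.

(* The sets on which [om] is 1 have nonempty finite intersections, since
   [om] is 0 on the empty set; complete them to an ultrafilter. *)
Lemma Omega_ultra (om : Omega (lc:=lc)) : exists2 G : set_system C,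
  UltraFilter G & forall e, \val om e <-> G (\val e).
Proof.
have [[[e0 ome0] omM _] omU] := set_valP om.
pose F : set_system C := filter_from [set A | charbar (\val om) A] id.
have FF : Filter F.
  apply: filter_from_filter; first by exists (\val e0); exact: charbar_J.
  by move=> A B omA omB; exists (A `&` B) => //; exact: charbar_setI.
(* If the difference were empty, the [f i] would cover [e], and the covering condition would make
   [om] equal to 1 on some [f i]. *)
have PF : ProperFilter F.
  apply: filter_from_proper => A [e [n [f [fe AE ome omf]]]].
  apply/set0P/negP => /eqP A0; have [] := omU e n f _ ome; last first.
    by move=> i; apply/negP.
  apply/seteqP; split=> [x ex|x [i _ /fe//]].
  apply: contrapT => nfx; suff : A x by rewrite A0.
  by rewrite AE.
have [G [uG FG]] := ultraFilterLemma PF; exists G => // e; split=> [ome|Ge].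
  by apply: FG; exists (\val e) => //; exact: charbar_J.
apply: contrapT => /negP nome.
(* For the converse, a character that is 0 on [e] is 1 on [e0] minus [e], which forces the
   complement of [e] into [G]. *)
have : charbar (\val om) (\val e0 `\` \bigcup_(i : 'I_1) \val (Jmeet e0 e)).
  apply/charbarE => [_ x []//|]; split=> // _.
  by rewrite omM (negbTE nome) andbF.
move=> H; have : G (~` \val e); last by move/ultra_setC; apply.
apply: FG; exists (\val e0 `\` \bigcup_(i : 'I_1) \val (Jmeet e0 e)) => //.
by move=> x [ex nex] e'x; apply: nex; exists ord0.
Qed.

(** Primality of the ultrafilter behind [om] extends the covering condition from [J] to [Jbar]. *)
Lemma charbar_bigcup {om : Omega (lc:=lc)} {eps : set C} {n : nat}
    {f : 'I_n -> set C} :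
  (forall i, Jbar lc (f i)) -> charbar (\val om) eps ->
  eps `<=` \bigcup_i f i -> exists i, charbar (\val om) (f i).
Proof.
move=> Jf ome ef; have [G uG omG] := Omega_ultra om.
have Ge : G eps by apply/(charbar_ultra uG omG) => //; exact: charbar_Jbar ome.
have /ultra_bigcup[i Gi] : G (\bigcup_i f i) by exact: filterS Ge.
by exists i; apply/(charbar_ultra uG omG).
Qed.

Lemma open_charbarC (eps : set C) : Jbar lc eps ->
  open [set om : Omega (lc:=lc) | ~ charbar (\val om) eps].
Proof.
move=> [e [n [f [fe ->]]]].
rewrite (_ : [set _ | _] = [set om : Omega (lc:=lc) | \val om e = false] `|`
    \bigcup_i [set om : Omega (lc:=lc) | \val om (f i) = true]).
  apply: openU; first exact: open_eval.
  by apply: bigcup_open => i _; exact: open_eval.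
apply/seteqP; split=> om /=.
  move=> H; apply: contrapT => /not_orP[ome omf]; apply: H.
  apply/charbarE => //; split; first by apply/negPn/negP => /negbTE.
  by move=> i; apply/negP => omfi; apply: omf; exists i.
move=> H /charbarE[] // ome omf; case: H => [|[i _]]; first by rewrite ome.
by move=> omfi; have /negP[] := omf i.
Qed.

Lemma Omega_neq (om om' : Omega (lc:=lc)) : om <> om' ->
  exists e, \val om e <> \val om' e.
Proof.
move=> neq; apply: contrapT => H; apply: neq; apply: val_inj.
by apply/funext => e; apply: contrapT => He; apply: H; exists e.
Qed.

Lemma point_char (x : C) :
  exists om : Omega (lc:=lc), forall e, \val om e <-> (\val e) x.
Proof.
(* Multiplication by the identity [tgt x] is defined at [x], so the principal ultrafilter at [x]
   gives a non-zero character. *)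
have Il_tgt : Il lc (lmul lc (tgt x)) by move=> M [_]; apply; exists (tgt x).
have ux : (\val (Jdom (set_elt Il_tgt))) x
  by exists x; split; rewrite ?src_tgt ?tgt_cmpl.
have [om omE] := ultra_Omega (principal_filter_ultra x)
  (iffRL (principal_filterP _ _) ux).
by exists om => e; rewrite omE principal_filterP.
Qed.

(** The point characters converge to [om] along [G]: in each coordinate [e] they are constant on [e]
    and on its complement, one of which lies in [G]. *)
Lemma point_char_nbhs {om : Omega (lc:=lc)} {pt : C -> Omega (lc:=lc)}
    {G : set_system C} {V : set (Omega (lc:=lc))} :
  UltraFilter G -> (forall e, \val om e <-> G (\val e)) ->
  (forall x e, \val (pt x) e <-> (\val e) x) ->
  open V -> V om -> G [set x | V (pt x)].
Proof.
move=> uG omG ptE [W oW <-] /= Wom.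
suff cv : (fun x => \val (pt x)) @ G --> (\val om : {ptws J lc -> bool}).
  exact: (cv W (open_nbhs_nbhs (conj oW Wom))).
apply/cvg_sup => e A; rewrite nbhsE => -[B [[O oO <-] /= Oom] BA].
apply: (@filterS _ _ _ [set x | O (\val (pt x) e)]).
  by move=> x /= Ox; apply: BA.
apply: (filterS (P := [set x | (\val e) x <-> \val om e])).
  move=> x /= xe; suff -> : \val (pt x) e = \val om e by [].
  by apply/idP/idP => [/ptE H|H]; [exact/xe/H|exact/ptE/xe].
have [ome|nome] := boolP (\val om e).
  by apply: filterS (iffLR (omG e) ome).
have : G (~` \val e) by apply/ultra_setC => /omG; exact/negP.
by apply: filterS => x nx.
Qed.

(** Associativity gives this for [lmul c], and it passes to composites and inverses. Equality of
    sources is carried along to keep the products composable. *)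
Lemma Il_cmp {s : pbij C} : Il lc s -> forall x y, graph s x y ->
  src x = src y /\ forall z, src x = tgt z -> graph s (cmp x z) (cmp y z).
Proof.
apply: (_ : Il lc `<=` [set s : pbij C | forall x y, graph s x y ->
  src x = src y /\ forall z, src x = tgt z -> graph s (cmp x z) (cmp y z)]).
apply: smallest_sub.
  split=> [t u Ht Hu x y /= [w /Hu[xw Hxw] /Ht[wy Hwy]]|t Ht x y /= /Ht[yx H]].
    split=> [|z xz]; first by rewrite xw.
    by exists (cmp w z); [exact: Hxw|apply: Hwy; rewrite -xw].
  by split=> // z xz; apply: H; rewrite yx.
move=> _ [c _ <-] x y /= [cx ->]; rewrite src_cmp//; split=> // z xz.
by rewrite tgt_cmp// cmpA.
Qed.

(* The witness is the right ideal generated by [x]: [s (x z) = s x z = x z]. *)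
Lemma pfix_ideal {s : pbij C} {x : C} : Il lc s -> pfix s x ->
  exists2 e : J lc, (\val e) x & \val e `<=` pfix s.
Proof.
move=> Is sx; have [Ic Ii] := Il_inverse_subsemigroup lc.
have Ix : Il lc (Defs.pinv (lmul lc x)) by apply: Ii => M [_]; apply; exists x.
exists (Jdom (set_elt Ix)) => /=.
  by exists (src x); split; rewrite ?tgt_src ?cmp_src.
by move=> _ [z [xz ->]]; have [_] := Il_cmp Is _ _ sx; exact.
Qed.

End Characters.

(** * The Hausdorff criterion, for both germ relations at once *)

Section Hausdorff.
Context {C : smallCategory} {lc : left_cancellative C}.
Variables (K : set (set C)) (r : equiv_rel (pairs lc)).
Hypothesis JK : J lc `<=` K.
Hypothesis KJbar : K `<=` Jbar lc.
Hypothesis KI : forall A (e : J lc), K A -> K (A `&` \val e).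
Hypothesis rE : forall p q, r p q <-> pchi p = pchi q /\
  exists2 eps, K eps /\ charbar (\val (pchi p)) eps &
    prestr (pel p) eps = prestr (pel q) eps.
Hypothesis r_open : forall p q, r p q -> exists W : set (Omega (lc:=lc)),
  [/\ open W, W (pchi p) & forall p' q', pel p' = pel p -> pel q' = pel q ->
    pchi p' = pchi q' -> W (pchi p') -> r p' q'].

Let r_source p q : r p q -> pchi p = pchi q.
Proof. by move=> /rE[]. Qed.

Lemma germ_class_eqP (s t : Il lc) (chi : OmegaAt s) (psi : OmegaAt t) :
  germ_class r chi = germ_class r psi <-> \val chi = \val psi /\
  exists eps, [/\ K eps, charbar (\val (\val chi)) eps
    & eps `<=` pfix (Defs.pcomp (Defs.pinv (\val t)) (\val s))].
Proof.
rewrite germ_class_eq rE /pchi /pel /=; split=> -[cp [eps]]; last first.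
  move=> [Keps ceps E]; split=> //; exists eps => //.
  apply: pbijP => x y /=; split=> -[ex xy]; split=> //;
    have [u su tu] := E x ex.
    by rewrite (graph_fun xy su).
  by rewrite (graph_fun xy tu).
(* The restrictions also agree where both maps are undefined, so [eps] is cut down to the domain of
   [s]. *)
move=> [Keps ceps] E; split=> //; exists (eps `&` \val (Jdom s)); split.
- exact: KI.
- by apply: charbar_setI => //; apply: charbar_J; exact: set_valP chi.
- move=> x [ex [y sxy]]; exists y => //.
  have : graph (prestr (\val s) eps) x y by [].
  by rewrite E => -[].
Qed.

Lemma germ_class_nbhs {s : Il lc} {chi : OmegaAt s} {A : set (germ_space r)} :
  nbhs (germ_class r chi) A -> exists W : set (Omega (lc:=lc)),
    [/\ open W, W (\val chi)
      & forall psi : OmegaAt s, W (\val psi) -> A (germ_class r psi)].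
Proof.
move=> /(@germ_class_continuous _ _ r s chi); rewrite /= nbhsE.
move=> [B [[W oW <-] /= Wchi] BA]; by exists W.
Qed.

Lemma hausdorff_germ_spaceP : hausdorff_space (germ_space r) <->
  forall s : pbij C, Il lc s -> exists (n : nat) (eps : 'I_n -> set C),
    (forall i, K (eps i)) /\ pfix s = \bigcup_i eps i.
Proof.
split=> [hr s Is|Kfix].
  apply: contrapT => nfix.
  pose K' := [set A | K A /\ A `<=` pfix s].
  (* Ultrafilters finer than [F] contain [pfix s] but no element of [K] inside it. *)
  pose F : set_system C := filter_from [set X | finite_set X /\ X `<=` K']
    (fun X => pfix s `\` \bigcup_(A in X) A).
  have FF : Filter F.
    apply: filter_from_filter; first by exists set0; split.
    move=> X Y [fX XK] [fY YK]; exists (X `|` Y).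
      by split; [rewrite finite_setU|rewrite subUset].
    by rewrite bigcup_setU setDUr.
  have PF : ProperFilter F.
    (* An empty generator would exhibit [pfix s] as a finite union of elements of [K]. *)
    apply: filter_from_proper => X [/finite_seqP[l Xl] XK].
    apply: contrapT => E; apply: nfix; exists (size l), (fun i => nth set0 l i).
    have lX i : i < size l -> X (nth set0 l i).
      by move=> il; rewrite Xl /=; exact: mem_nth.
    split=> [i|]; first by have [] := XK _ (lX i (ltn_ord i)).
    apply/seteqP; split=> [x sx|x [i _]]; last first.
      by have [_] := XK _ (lX i (ltn_ord i)); exact.
    apply: contrapT => nx; apply: E; exists x; split=> // -[A XA Ax].
    move: XA; rewrite Xl /= => Al; apply: nx.
    have Asl : index A l < size l by rewrite index_mem.
    by exists (Ordinal Asl) => //=; rewrite nth_index.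
  have [G [uG FG]] := ultraFilterLemma PF.
  have Gs : G (pfix s).
    apply: FG; exists set0; first by split.
    by move=> x [].
  pose sI : Il lc := set_elt Is.
  have [Ic Ii] := Il_inverse_subsemigroup lc.
  pose iI : Il lc := set_elt (Ic _ _ (Ii _ Is) Is).
  have GJs : G (\val (Jdom sI)) by apply: filterS Gs => x sx; exists x.
  have GJi : G (\val (Jdom iI)).
    by apply: filterS Gs => x sx; exists x, x.
  have [om omG] := ultra_Omega uG GJs.
  pose chi : OmegaAt sI := @set_elt _ (OmegaAt sI) om (iffRL (omG _) GJs).
  pose psi : OmegaAt iI := @set_elt _ (OmegaAt iI) om (iffRL (omG _) GJi).
  have : germ_class r chi = germ_class r psi.
    have [pt ptE] := choice (@point_char C lc).
    apply: hr => A B /germ_class_nbhs[V [oV Vom VA]].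
    move=> /germ_class_nbhs[W [oW Wom WB]].
    have [x [sx [Vx Wx]]] := filter_ex (filterI Gs (filterI
      (point_char_nbhs uG omG ptE oV Vom) (point_char_nbhs uG omG ptE oW Wom))).
    have xs : \val (pt x) (Jdom sI) by apply/ptE; exists x.
    have xi : \val (pt x) (Jdom iI) by apply/ptE; exists x, x.
    exists (germ_class r (@set_elt _ (OmegaAt sI) (pt x) xs)); split.
      exact: VA.
    rewrite (_ : germ_class r _ =
      germ_class r (@set_elt _ (OmegaAt iI) (pt x) xi)).
      exact: WB.
    apply/germ_class_eqP; split=> //=.
    have [e ex es] := pfix_ideal Is sx; exists (\val e); split.
    - exact/JK/set_valP.
    - exact/charbar_J/ptE.
    - by move=> y /es sy; exists y => //; exists y.
  (* Equality of the germs puts into [G] some [eps] in [K] inside [pfix s], whose complement lies in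
     [F]. *)
  move=> /germ_class_eqP[_ [eps [Keps ceps epsE]]].
  have K'eps : K' eps.
    split=> // x /epsE[u su [v sxv suv]].
    by rewrite /pfix /= {2}(graph_inj sxv suv).
  have : G (~` eps); last first.
    move=> /ultra_setC; apply; apply/(charbar_ultra uG omG) => //.
    exact: KJbar.
  apply: FG; exists [set eps]; first by split=> // A ->.
  by move=> x [_ nx] ex; apply: nx; exists eps.
move=> p q; rewrite -(reprK p) -(reprK q).
case: (repr p) (repr q) => s chi [t psi] pq.
have cp : \val chi = \val psi.
  (* Distinct sources are separated by their values at some [e], pulled back along the continuous
     source map. *)
  apply: contrapT => /Omega_neq[e ne].
  pose A (om : Omega (lc:=lc)) : set (germ_space r) :=
    @germ_source _ _ r @^-1` [set om' | \val om' e = \val om e].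
  have nA u (om : OmegaAt u) : nbhs (germ_class r om) (A (\val om)).
    apply: open_nbhs_nbhs; split; last by rewrite /A /= germ_sourceE.
    have /continuousP := @germ_source_continuous _ _ r r_source.
    by apply; exact: open_eval.
  have [g [/= ga gb]] := pq _ _ (nA s chi) (nA t psi).
  by apply: ne; rewrite -ga -gb.
apply/germ_class_eqP; split=> //.
have [Ic Ii] := Il_inverse_subsemigroup lc.
have [n [eps [Keps epsE]]] :=
  Kfix _ (Ic _ _ (Ii _ (set_valP t)) (set_valP s)).
have [[i ci]|nc] := pselect (exists i, charbar (\val (\val chi)) (eps i)).
  by exists (eps i); split=> // x ex; rewrite epsE; exists i.
pose W := [set om : Omega (lc:=lc) | forall i, ~ charbar (\val om) (eps i)].
have oW : open W.
  rewrite openE => om Wom; rewrite /interior.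
  apply: (@filter_forall _ _ (fun i => [set om' : Omega (lc:=lc) |
    ~ charbar (\val om') (eps i)]) (nbhs om) _) => i.
  by apply: open_nbhs_nbhs; split; [exact/open_charbarC/KJbar|exact: Wom].
have nW u (om : OmegaAt u) : W (\val om) ->
    nbhs (germ_class r om) (@germ_class _ _ r u @` [set om | W (\val om)]).
  move=> Wom; apply: open_nbhs_nbhs; split; last by exists om.
  by apply: germ_class_open => //; exists W.
have Wchi : W (\val chi) by move=> i ci; apply: nc; exists i.
have Wpsi : W (\val psi) by rewrite -cp.
(* A common point is a germ of both [s] and [t] over one [om] in [W]; then [om] is 1 on some [d]
   covered by the [eps i], hence on one of them. *)
have [_ [[om Wom <-] [om' _ E]]] := pq _ _ (nW s chi Wchi) (nW t psi Wpsi).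
have /germ_class_eqP[_ [d [Kd cd dE]]] := esym E.
rewrite epsE in dE.
have [i ci] := charbar_bigcup (fun i => KJbar _ (Keps i)) cd dE.
by have := Wom i.
Qed.

End Hausdorff.

Theorem lemma4p1 (C : smallCategory) (lc : left_cancellative C) :
  (hausdorff_space (germs lc) <->
    forall s : pbij C, Il lc s ->
      exists (n : nat) (e : 'I_n -> set C),
        (forall i, J lc (e i)) /\ pfix s = \bigcup_i e i) /\
  (hausdorff_space (germsbar lc) <->
    forall s : pbij C, Il lc s ->
      exists (n : nat) (eps : 'I_n -> set C),
        (forall i, Jbar lc (eps i)) /\ pfix s = \bigcup_i eps i).
Proof.
have J_Jbar (e : J lc) : Jbar lc (\val e).
  exists e, 0, (fun=> e); split=> [[]//|].
  by rewrite (_ : \bigcup_i _ = set0) ?setD0//; apply/seteqP; split=> // x [[]].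
split; apply: hausdorff_germ_spaceP => //.
- by move=> A JA; exact: (J_Jbar (set_elt JA)).
- by move=> A e JA; have /set_mem := J_setI (set_elt JA) e.
- move=> p q; split=> [/asboolP[pq [e ce E]]|[pq [A [JA cA] E]]].
    split=> //; exists (\val e) => //; split; first exact: set_valP.
    exact: charbar_J.
  apply/asboolP; split=> //; exists (set_elt JA) => //.
  (* [charbar] provides only some expression of [A] as a difference; membership in [G] turns it into
     the value of the character at [A]. *)
  have [G uG omG] := Omega_ultra (pchi p).
  by apply/omG/(charbar_ultra uG omG) => //; exact: (J_Jbar (set_elt JA)).
- exact: germ_rel_open.
- by move=> A [s Is <-]; exact: (J_Jbar (set_elt (ex_intro2 _ _ s Is erefl))).
- move=> _ e [e0 [n [f [fe ->]]]].
  (* Intersecting a difference with [e] amounts to intersecting each of its terms with [e]. *)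
  exists (Jmeet e0 e), n, (fun i => Jmeet (f i) e); split=> [i x [/fe]//|].
  apply/seteqP; split=> x /=.
    by move=> [[e0x nf] ex]; split=> // -[i _ [fx _]]; apply: nf; exists i.
  by move=> [[e0x ex] nf]; do !split=> //; move=> [i _ fx]; apply: nf; exists i.
- by move=> p q; split=> [/asboolP|?]; last exact/asboolP.
- exact: germbar_rel_open.
Qed.
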